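(* Let $\mathcal{G}$ be a weighted digraph on $n\ge 2$ nodes that is a directed spanning tree with root $v_1$, with edges labelled $e_1,\dots,e_{n-1}$ so that $e_i$ is the unique edge pointing towards $v_{i+1}$, with positive weight $a_i$, and let $B\in\mathbb{R}^{n\times(n-1)}$ be its incidence matrix. Let $\bar g:\mathbb{R}\to\mathbb{R}$ be an increasing (not necessarily continuous, not necessarily strictly increasing) function with $\lim_{y\to\infty}|\bar g(y)|=\infty$ and $\bar g(0)=0$. Consider the system $$\dot x_1=0,\qquad \dot x_{i+1}=a_i\,\bar g(B_{\cdot,i}^\top x),\quad i=1,\dots,n-1,$$ where $B_{\cdot,i}^\top x=x_{p}-x_{i+1}$ with $v_p$ the parent of $v_{i+1}$ in the tree. Then every Filippov solution $x:[0,\infty)\to\mathbb{R}^n$ of this system converges asymptotically (as $t\to\infty$, in the sense that its distance to the set tends to $0$) to the set $$\mathcal{H}_3=\{x\in\mathbb{R}^n\mid \exists \alpha\in\mathcal{F}[\bar g](0)\ \text{such that}\ \alpha\in a_i\,\mathcal{F}[\bar g](B_{\cdot,i}^\top x)\ \text{for all } i=1,\dots,n-1\}.$$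
   Context: A directed spanning tree with root $v_1$: every node other than $v_1$ has exactly one incoming edge (from its parent), $v_1$ has none, and there is a directed path from $v_1$ to every other node. Incidence matrix $B$: the $(j,k)$ entry is $1$ if the edge $e_k$ originates from $v_j$, $-1$ if it points towards $v_j$, and $0$ otherwise; $B_{\cdot,k}$ is the $k$-th column. For a map $X:\mathbb{R}^p\to\mathbb{R}^p$ the Filippov set-valued map is $\mathcal{F}[X](x)=\bigcap_{\delta>0}\bigcap_{\mu(S)=0}\overline{\mathrm{co}}\{X(B(x,\delta)\setminus S)\}$, where here $B(x,\delta)$ is the open ball, $\mu$ is Lebesgue measure and $\overline{\mathrm{co}}$ is the closed convex hull. A Filippov solution of $\dot x=X(x)$ is a (locally) absolutely continuous function $x(t)$ with $\dot x(t)\in\mathcal{F}[X](x(t))$ for almost every $t$. *)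

(* Defs.v *)
From HB Require Import structures.
From mathcomp Require Import all_boot all_order all_algebra.
From mathcomp Require Import all_classical all_reals all_analysis.

Set Implicit Arguments.
Unset Strict Implicit.
Unset Printing Implicit Defensive.

Import Order.TTheory GRing.Theory Num.Theory.
Import numFieldNormedType.Exports.

Local Open Scope classical_set_scope.
Local Open Scope ring_scope.

(* Column vectors ['cV[R]_p] carry the sup norm in the library; balls, total
   variations and distances below are taken in the Euclidean norm.  Closedness
   and derivatives use the library topology, which is the usual one of R^p. *)
Definition euclid_norm (R : realType) (p : nat) (x : 'cV[R]_p) : R :=
  Num.sqrt (\sum_(i < p) x i 0 ^+ 2).

Definition euclid_ball (R : realType) (p : nat) (x : 'cV[R]_p) (r : R) :
    set 'cV[R]_p :=
  [set y | euclid_norm (y - x) < r].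

(* Infimum in the extended reals, so that the distance to the empty set is
   [+oo] rather than [0]. *)
Definition euclid_dist (R : realType) (p : nat) (x : 'cV[R]_p)
    (A : set 'cV[R]_p) : \bar R :=
  ereal_inf [set (euclid_norm (x - y))%:E | y in A].

Definition box (R : realType) (p : nat) (lo hi : 'cV[R]_p) : set 'cV[R]_p :=
  [set x | forall i, lo i 0 <= x i 0 <= hi i 0].

Definition box_volume (R : realType) (p : nat) (lo hi : 'cV[R]_p) : R :=
  \prod_(i < p) (hi i 0 - lo i 0).

(* Lebesgue outer measure on R^p: infimum of the total volumes of the countable
   covers by boxes. *)
Definition lebesgue_outer (R : realType) (p : nat) (S : set 'cV[R]_p) : \bar R :=
  ereal_inf [set (\sum_(0 <= k <oo) (box_volume (c k).1 (c k).2)%:E)%E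
    | c in [set c : nat -> 'cV[R]_p * 'cV[R]_p |
        (forall k i, (c k).1 i 0 <= (c k).2 i 0) /\
        S `<=` \bigcup_k box (c k).1 (c k).2]].

Definition closed_convex_hull (R : realType) (p : nat) (A : set 'cV[R]_p) :
    set 'cV[R]_p :=
  \bigcap_(C in [set C : set 'cV[R]_p | [/\ closed C, convex_set C & A `<=` C]]) C.

Definition filippov (R : realType) (p : nat) (X : 'cV[R]_p -> 'cV[R]_p)
    (x : 'cV[R]_p) : set 'cV[R]_p :=
  \bigcap_(d in [set d : R | 0 < d])
    \bigcap_(S in [set S : set 'cV[R]_p | lebesgue_outer S = 0%E])
      closed_convex_hull (X @` (euclid_ball x d `\` S)).

(* The case p = 1, with R^1 identified with R through [y |-> y%:M]. *)
Definition filippov1 (R : realType) (g : R -> R) (y : R) : set R :=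
  [set v | filippov (fun u : 'cV[R]_1 => (g (u 0 0))%:M) y%:M v%:M].

Definition abs_continuous (R : realType) (p : nat) (a b : R)
    (x : R -> 'cV[R]_p) : Prop :=
  forall e : R, 0 < e -> exists2 d : R, 0 < d &
    forall (N : nat) (s t : 'I_N -> R),
      (forall k, [/\ a <= s k, s k <= t k & t k <= b]) ->
      trivIset setT (fun k => [set u | s k < u < t k]) ->
      \sum_(k < N) (t k - s k) < d ->
      \sum_(k < N) euclid_norm (x (t k) - x (s k)) < e.

(* Solutions on [0, +oo); the values of [x] at negative times are irrelevant. *)
Definition filippov_solution (R : realType) (p : nat)
    (X : 'cV[R]_p -> 'cV[R]_p) (x : R -> 'cV[R]_p) : Prop :=
  (forall a b : R, 0 <= a -> a <= b -> abs_continuous a b x) /\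
  {ae (@lebesgue_measure R), forall t : R, 0 <= t ->
    derivable x t 1 /\ filippov X (x t) ('D_1 x t)}.

Record wdigraph (R : realType) (n m : nat) := WDigraph {
  src : 'I_m -> 'I_n;
  tgt : 'I_m -> 'I_n;
  weight : 'I_m -> R }.

Definition edge_rel (R : realType) (n m : nat) (G : wdigraph R n m) : rel 'I_n :=
  fun u v => [exists k, (src G k == u) && (tgt G k == v)].

Definition directed_spanning_tree (R : realType) (n m : nat)
    (G : wdigraph R n m) (r : 'I_n) : Prop :=
  [/\ forall v, v != r -> exists! k, tgt G k = v,
      forall k, tgt G k != r
    & forall v, connect (edge_rel G) r v].

Definition incidence (R : realType) (n m : nat) (G : wdigraph R n m) :
    'M[R]_(n, m) :=
  \matrix_(j, k) if src G k == j then 1 else if tgt G k == j then -1 else 0.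

Definition edge_diff (R : realType) (n m : nat) (G : wdigraph R n m)
    (i : 'I_m) (x : 'cV[R]_n) : R :=
  ((col i (incidence G))^T *m x) 0 0.

(* The node v_1 is [ord0], and v_(i+1) is [lift ord0 i], for the i-th edge. *)
Definition tree_field (R : realType) (m : nat) (G : wdigraph R m.+1 m)
    (g : R -> R) (x : 'cV[R]_m.+1) : 'cV[R]_m.+1 :=
  \col_j if unlift ord0 j is Some i then weight G i * g (edge_diff G i x) else 0.

Definition H3 (R : realType) (n m : nat) (G : wdigraph R n m) (g : R -> R) :
    set 'cV[R]_n :=
  [set x | exists2 alpha : R, filippov1 g 0 alpha &
    forall i : 'I_m,
      [set weight G i * b | b in filippov1 g (edge_diff G i x)] alpha].

(* Main.v *)
(* Every solution converges to a point of H_3, with alpha = 0.  The root is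
   constant.  Along an edge from p to i, if x_p tends to c then x_i can only
   decrease while x_i > c, and only increase while x_i < c, up to an
   arbitrarily small error; hence x_i converges, and since it cannot drift
   linearly, gbar is <= 0 to the left and >= 0 to the right of the limit of
   x_p - x_i, that is, 0 is in F[gbar] there.  Following the paths from the root
   gives all the nodes. *)

Require Import Defs.
From HB Require Import structures.
From mathcomp Require Import all_boot all_order all_algebra.
From mathcomp Require Import all_classical all_reals all_analysis.
From mathcomp Require Import unstable measurable_realfun ring lra.

Set Implicit Arguments.
Unset Strict Implicit.
Unset Printing Implicit Defensive.

Import Order.TTheory GRing.Theory Num.Theory.
Import numFieldNormedType.Exports.

Local Open Scope classical_set_scope.
Local Open Scope ring_scope.

(** * Slope bounds for absolutely continuous functions *)

(** Let [c] be the supremum of the [r] with [P a r]. The local property at [c] and additivity give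
    [P a c], and if [c < b] they carry [P a] beyond [c], a contradiction. *)
Lemma cousin_interval (R : realType) (P : R -> R -> Prop) (a b : R) :
  a <= b -> P a a ->
  (forall s r t, a <= s -> s <= r -> r <= t -> t <= b ->
    P s r -> P r t -> P s t) ->
  (forall r, a <= r <= b -> exists2 d, 0 < d &
    forall s t, a <= s -> s <= r -> r <= t -> t <= b -> t - s < d -> P s t) ->
  P a b.
Proof.
move=> ab Paa Ptr Ploc.
pose A := [set r | a <= r <= b /\ P a r].
have Aa : A a by split; rewrite // lexx ab.
have ubA : ubound A b by move=> r [/andP[]].
have hsA : has_sup A by split; [exists a|exists b].
pose c := sup A.
have ac : a <= c by apply: ub_le_sup => //; exists b.
have cb : c <= b by apply: ge_sup => //; exists a.
have [|d d0 Pd] := Ploc c; first by rewrite ac cb.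
have [r [/andP[ar rb] Par] cr] := sup_adherent d0 hsA.
have rc : r <= c by apply: ub_le_sup; [exists b|split => //; rewrite ar rb].
have Pac : P a c.
  apply: (Ptr a r c) => //; apply: Pd => //.
  by move: cr; rewrite -/c; lra.
have [<-//|cb'] := eqVneq c b.
have {}cb : c < b by rewrite lt_neqAle cb' cb.
pose t := Num.min (c + d / 2) b.
have ct : c < t by rewrite lt_min cb andbT; lra.
have tb : t <= b by rewrite ge_min lexx orbT.
have td : t <= c + d / 2 by rewrite ge_min lexx.
have At : A t.
  split; first by rewrite tb andbT; lra.
  apply: (Ptr a c t) => //; first exact: ltW.
  by apply: Pd => //; [exact: ltW|lra].
by have : t <= c by [apply: ub_le_sup => //; exists b]; rewrite leNgt ct.
Qed.

Definition scalar_abs_continuous (R : realType) (a b : R) (f : R -> R) : Prop :=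
  forall e : R, 0 < e -> exists2 d : R, 0 < d &
    forall (N : nat) (s t : 'I_N -> R),
      (forall k, [/\ a <= s k, s k <= t k & t k <= b]) ->
      trivIset setT (fun k => [set u | s k < u < t k]) ->
      \sum_(k < N) (t k - s k) < d ->
      \sum_(k < N) `|f (t k) - f (s k)| < e.

Lemma sum_itv_le_measure (R : realType) (U : set R) (N : nat) (s t : 'I_N -> R) :
  measurable U -> (forall k, s k <= t k) ->
  (forall k, [set u | s k < u < t k] `<=` U) ->
  trivIset setT (fun k => [set u | s k < u < t k]) ->
  ((\sum_(k < N) (t k - s k))%:E <= lebesgue_measure U)%E.
Proof.
move=> mU st sU tI.
have Eitv k : [set u | s k < u < t k] = `]s k, t k[%classic.
  by apply/seteqP; split => u /=; rewrite in_itv.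
have mI k : measurable [set u | s k < u < t k] by rewrite Eitv.
have -> : (\sum_(k < N) (t k - s k))%:E =
   (\sum_(k < N) lebesgue_measure [set u | (s k < u < t k)%R])%E.
  rewrite -sumEFin; apply: eq_bigr => k _.
  rewrite Eitv lebesgue_measure_itv /= lte_fin.
  have := st k; rewrite le_eqVlt => /orP[/eqP ->|->]; last by [].
  by rewrite ltxx subrr.
rewrite -measure_bigsetU_ord //.
apply: le_measure; rewrite ?inE //.
  by apply: bigsetU_measurable => k _; exact: mI.
by elim/big_ind: _ => [//|A B AU BU|k _]; [rewrite subUset|exact: sU].
Qed.

Lemma derivative_lower_slope (R : realType) (f : R -> R) (r k e : R) :
  derivable f r 1 -> k <= 'D_1 f r -> 0 < e ->
  exists2 d : R, 0 < d & forall s t, s <= r -> r <= t -> t - s < d ->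
    (k - e) * (t - s) <= f t - f s.
Proof.
move=> df kf e0.
have := df; rewrite /derivable => /cvgP.
rewrite -/('D_1 f r) => /cvgrPdist_lt /(_ _ e0).
rewrite near_withinE => /nbhs_ballP[d /= d0 H].
have slope h : `|h| < d -> h != 0 -> k - e <= h^-1 * (f (h + r) - f r).
  move=> hd h0.
  have := H h; rewrite /ball /= sub0r normrN => /(_ hd h0).
  have -> : h^-1 *: (f (h%:A + r) - f r) = h^-1 * (f (h + r) - f r).
    by rewrite [h%:A]mulr1.
  by move=> /ltr_normlP[_]; lra.
exists d => // s t sr rt tsd.
have H1 : (k - e) * (t - r) <= f t - f r.
  have [->|tr] := eqVneq t r; first by rewrite !subrr mulr0.
  have tr0 : 0 < t - r by rewrite subr_gt0 lt_neqAle eq_sym tr.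
  have := slope (t - r); rewrite subrK gtr0_norm // subr_eq0 tr.
  move=> /(_ _ isT); rewrite mulrC ler_pdivlMr //; apply; lra.
have H2 : (k - e) * (r - s) <= f r - f s.
  have [->|sr'] := eqVneq s r; first by rewrite !subrr mulr0.
  have sr0 : s - r < 0 by rewrite subr_lt0 lt_neqAle sr'.
  have := slope (s - r); rewrite subrK ltr0_norm // subr_eq0 sr'.
  move=> /(_ _ isT); rewrite mulrC ler_ndivlMr // => h.
  have : f s - f r <= (k - e) * (s - r) by apply: h; lra.
  by rewrite -!(opprB r s) -(opprB (f r)) mulrN lerN2.
have -> : (k - e) * (t - s) = (k - e) * (t - r) + (k - e) * (r - s) by ring.
by lra.
Qed.

(* Off an open set U of small measure containing the exceptional null set, the
   derivative controls the small increments; inside U, absolute continuity does.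
   Cousin's lemma glues both kinds of intervals, the list recording those in U. *)
Lemma abs_continuous_slope_ge (R : realType) (f : R -> R) (a b k : R) :
  a <= b -> scalar_abs_continuous a b f ->
  {ae (@lebesgue_measure R),
    forall t, a <= t <= b -> derivable f t 1 /\ k <= 'D_1 f t} ->
  k * (b - a) <= f b - f a.
Proof.
move=> ab acf [A [mA A0 subA]].
suff main e : 0 < e -> e < 1 ->
    (k - e) * (b - a) - e - `|k - e| * e <= f b - f a.
  rewrite leNgt; apply/negP => lt_slope.
  pose D := k * (b - a) - (f b - f a).
  have D0 : 0 < D by rewrite subr_gt0.
  (* [M] bounds the coefficient of [e] in the error, as [|k - e| <= |k| + 1] for [e < 1]. The [e]
     chosen next then makes the error at most half of [D]. *)
  pose M := (b - a) + 1 + (`|k| + 1).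
  have M0 : 0 < M by rewrite /M; have := normr_ge0 k; lra.
  pose e := Num.min (1 / 2) (D / (2 * M)).
  have e0 : 0 < e by rewrite lt_min divr_gt0 //= divr_gt0 // mulr_gt0.
  have e1 : e < 1 by rewrite gt_min; apply/orP; left; lra.
  have eM : e * M <= D / 2.
    rewrite -ler_pdivlMr // ge_min; apply/orP; right.
    by rewrite invfM mulrA.
  have ke : `|k - e| <= `|k| + 1.
    by rewrite (le_trans (ler_normB _ _)) // lerD2l gtr0_norm // ltW.
  have := main e e0 e1; have := ler_wpM2r (ltW e0) ke.
  move: eM D0; rewrite /M /D; set K := `|k|; set Ke := `|k - e|.
  nra.
move=> e0 e1.
have [d d0 acd] := acf e e0.
(* The bound by [d] serves absolute continuity inside [U]; the bound by [e] makes the term [|k - e|]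
   times the total length small. *)
pose d' := Num.min d e.
have d'0 : 0 < d' by rewrite lt_min d0.
have finA : (lebesgue_measure A < +oo)%E by rewrite A0 ltry.
have [U [oU AU mUA]] := lebesgue_regularity_outer mA finA d'0.
have mU : measurable U by exact: open_measurable.
have muU : (lebesgue_measure U < d'%:E)%E.
  rewrite -(setDUK AU) measureU //; last 2 first.
  - exact: measurableD.
  - by rewrite setDIK.
  by rewrite [X in (X + _)%E]A0 add0e.
(* [incr p] is the excess of the increment of [f] over slope [k - e] on one listed interval. [good]
   asks for slope [k - e] on the whole, up to these excesses. *)
pose incr (p : R * R) := (f p.2 - f p.1) - (k - e) * (p.2 - p.1).
pose good s t (l : seq (R * R)) :=
  [/\ forall p, p \in l -> [/\ s <= p.1, p.1 <= p.2, p.2 <= t &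
        [set u | p.1 < u < p.2] `<=` U],
      pairwise (fun p q : R * R => p.2 <= q.1) l &
      (k - e) * (t - s) + \sum_(p <- l) incr p <= f t - f s].
have [l [lP lpw lf]] : exists l, good a b l.
  apply: (@cousin_interval _ (fun s t => exists l, good s t l)) => //.
  - by exists [::]; split => //; rewrite big_nil !subrr mulr0 addr0.
  - move=> s r t _ sr rt _ [l1 [P1 pw1 f1]] [l2 [P2 pw2 f2]].
    exists (l1 ++ l2); split.
    + move=> p; rewrite mem_cat => /orP[/P1|/P2] [h1 h2 h3 h4]; split => //.
        exact: le_trans rt.
      exact: le_trans h1.
    + rewrite pairwise_cat pw1 pw2 !andbT; apply/allrelP => p q /P1[_ _ pr _].
      by move=> /P2[rq _ _ _]; exact: le_trans rq.
    + rewrite big_cat /=; move: f1 f2.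
      set S1 := \sum_(i <- l1) _; set S2 := \sum_(i <- l2) _.
      have -> : (k - e) * (t - s) = (k - e) * (r - s) + (k - e) * (t - r).
        by ring.
      by lra.
  - move=> r /andP[ar rb]; have [rU|rU] := pselect (U r).
      have /nbhs_ballP[c /= c0 cU] : nbhs r U by exact: open_nbhs_nbhs.
      exists c => // s t as_ sr rt tb tsc.
      exists [:: (s, t)]; split => //.
        move=> p; rewrite inE => /eqP -> /=; split => //.
          exact: le_trans rt.
        move=> u /= /andP[su ut]; apply: cU; rewrite /ball /=.
        by apply/ltr_normlP; split; lra.
      by rewrite big_seq1 /incr /= addrC subrK.
    (* Outside [U] the point avoids the exceptional null set, so the slope bound holds with the
       empty list. *)
    have [dr kr] : derivable f r 1 /\ k <= 'D_1 f r.
      apply: contrapT => h; apply: rU; apply: AU; apply: subA => /= h'.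
      by apply: h; apply: h'; rewrite ar.
    have [c c0 H] := derivative_lower_slope dr kr e0.
    exists c => // s t as_ sr rt tb tsc.
    by exists [::]; split => //; rewrite big_nil addr0; exact: H.
pose s (i : 'I_(size l)) := (nth (a, a) l i).1.
pose t (i : 'I_(size l)) := (nth (a, a) l i).2.
have lP' (i : 'I_(size l)) : [/\ a <= s i, s i <= t i, t i <= b &
    [set u | s i < u < t i] `<=` U].
  by apply: lP; exact: mem_nth.
have tI : trivIset setT (fun i => [set u | s i < u < t i]).
  move=> i j _ _ [u [/= /andP[siu uti] /andP[sju utj]]].
  apply/val_inj/eqP; rewrite eq_le; move/(pairwiseP (a, a)): lpw => lpw.
  apply/andP; split; rewrite leNgt; apply/negP => ij.
    have := lpw j i (ltn_ord _) (ltn_ord _) ij; rewrite -/(t j) -/(s i).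
    by lra.
  have := lpw i j (ltn_ord _) (ltn_ord _) ij; rewrite -/(t i) -/(s j).
  by lra.
have len_lt : \sum_i (t i - s i) < d'.
  rewrite -lte_fin; apply: le_lt_trans muU; apply: sum_itv_le_measure => //.
  - by move=> i; have [] := lP' i.
  - by move=> i; have [] := lP' i.
have var_lt : \sum_i `|f (t i) - f (s i)| < e.
  apply: acd => //; last by apply: (lt_le_trans len_lt); rewrite ge_min lexx.
  by move=> i; have [] := lP' i.
have len_e : \sum_i (t i - s i) <= e.
  by apply: (le_trans (ltW len_lt)); rewrite ge_min lexx orbT.
have incr_ge : - (e + `|k - e| * e) <= \sum_(p <- l) incr p.
  rewrite (big_nth (a, a)) big_mkord lerNl -sumrN.
  apply: (@le_trans _ _ (\sum_(i < size l)
      (`|f (t i) - f (s i)| + `|k - e| * (t i - s i)))).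
    apply: ler_sum => i _; rewrite /incr -/(s i) -/(t i) opprB addrC.
    apply: lerD; first by rewrite -normrN ler_norm.
    by apply: ler_wpM2r (ler_norm _); rewrite subr_ge0; have [] := lP' i.
  rewrite big_split /= -mulr_sumr; apply: lerD; first exact: ltW.
  exact: ler_wpM2l.
by move: lf incr_ge; set S := \sum_(p <- l) _; lra.
Qed.

(** * Barriers and limits of scalar functions *)

Lemma scalar_abs_continuous_unif (R : realType) (a b : R) (f : R -> R) (e : R) :
  scalar_abs_continuous a b f -> 0 < e -> exists2 d : R, 0 < d &
    forall s t, a <= s -> s <= t -> t <= b -> t - s < d -> `|f t - f s| < e.
Proof.
move=> acf e0; have [d d0 H] := acf e e0; exists d => // s t as_ st tb tsd.
have := H 1%N (fun=> s) (fun=> t); rewrite !big_ord1; apply => //.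
by move=> i j _ _ _; rewrite !ord1.
Qed.

Lemma scalar_abs_continuousN (R : realType) (a b : R) (f : R -> R) :
  scalar_abs_continuous a b f -> scalar_abs_continuous a b (fun t => - f t).
Proof.
move=> acf e e0; have [d d0 H] := acf e e0; exists d => // N s t h tI ltd.
rewrite (eq_bigr (fun k => `|f (t k) - f (s k)|)); first exact: H.
by move=> k _; rewrite -normrN opprB opprK addrC.
Qed.

(** Take for [r] the supremum of the points where [f <= v]. Continuity gives [f r <= v]; later
    points have [f > v], so continuity on the right excludes [f r < v]. *)
Lemma last_crossing (R : realType) (a b v : R) (f : R -> R) :
  a <= b -> scalar_abs_continuous a b f -> f a <= v -> v < f b ->
  exists r, [/\ a <= r, r <= b, f r <= v & forall q, r <= q <= b -> v <= f q].
Proof.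
move=> ab acf fav vfb.
pose A := [set r | a <= r <= b /\ f r <= v].
have Aa : A a by split; rewrite // lexx ab.
have ubA : ubound A b by move=> r [/andP[]].
have hsA : has_sup A by split; [exists a|exists b].
pose c := sup A.
have Ac r : A r -> r <= c by move=> Ar; apply: ub_le_sup => //; exists b.
have ac : a <= c by exact: Ac.
have cb : c <= b by apply: ge_sup => //; exists a.
have fc : f c <= v.
  rewrite leNgt; apply/negP => vfc.
  have [|d d0 fd] := scalar_abs_continuous_unif (e := f c - v) acf.
    by rewrite subr_gt0.
  have [r [/andP[ar rb] frv]] := sup_adherent d0 hsA.
  rewrite -/c => cr; have rc : r <= c by apply: Ac; split; rewrite // ar.
  have /ltr_normlP[_] := fd r c ar rc cb (ltac:(lra)).
  by lra.
have out q : c < q -> q <= b -> v < f q.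
  move=> cq qb; rewrite ltNge; apply/negP => fqv.
  have : q <= c by apply: Ac; split => //; rewrite qb andbT (le_trans ac) // ltW.
  by rewrite leNgt cq.
exists c; split => // q /andP[].
rewrite le_eqVlt => /predU1P[<- _|cq qb]; last exact: ltW (out _ cq qb).
rewrite leNgt; apply/negP => fcv.
have cb' : c < b.
  rewrite lt_neqAle cb andbT; apply/eqP => cbE.
  by move: vfb; rewrite -cbE ltNge fc.
have [|d d0 fd] := scalar_abs_continuous_unif (e := v - f c) acf.
  by rewrite subr_gt0.
pose p := Num.min (c + d / 2) b.
have cp : c < p by rewrite lt_min cb' andbT; lra.
have pb : p <= b by rewrite ge_min lexx orbT.
have pd : p <= c + d / 2 by rewrite ge_min lexx.
have /ltr_normlP[_] := fd c p ac (ltW cp) pb (ltac:(lra)).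
by have := out p cp pb; lra.
Qed.

(** Once at or below [v], [u] cannot climb back, because it does not increase while above [v].
    Otherwise it stays above [v] forever, nonincreasing and bounded below. *)
Lemma upper_barrier_cvg (R : realType) (u : R -> R) (v T : R) :
  (forall s t : R, T <= s -> s <= t -> scalar_abs_continuous s t u) ->
  (forall s t : R, T <= s -> s <= t -> (forall q, s <= q <= t -> v < u q) ->
    u t <= u s) ->
  (exists l : R, u t @[t --> +oo] --> l) \/ \forall t \near +oo_R, u t <= v.
Proof.
move=> acu dec.
have barrier s t : T <= s -> s <= t -> u s <= v -> u t <= v.
  move=> Ts st usv; rewrite leNgt; apply/negP => vut.
  (* After its last crossing of a level, [u] is only known to be at least that level; a level
     strictly above [v] gives the strict inequality that [dec] requires. *)
  pose v' := (v + u t) / 2.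
  have usv' : u s <= v' by rewrite /v'; lra.
  have v'ut : v' < u t by rewrite /v'; lra.
  have [r [sr rt urv' hr]] := last_crossing st (acu s t Ts st) usv' v'ut.
  have : u t <= u r.
    apply: dec => //; first exact: le_trans sr.
    by move=> q /hr; rewrite /v'; lra.
  by lra.
have [[s [Ts usv]]|above] := pselect (exists s, T <= s /\ u s <= v).
  by right; near=> t; apply: (barrier s) => //; near: t; exact: nbhs_pinfty_ge.
have {}above t : T <= t -> v < u t.
  by move=> Tt; rewrite ltNge; apply/negP => utv; apply: above; exists t.
(* Freezing the time before [T] and changing sign makes the function nondecreasing on the whole
   line. *)
left; pose f t := - u (Num.max T t).
have T_max t : T <= Num.max T t by rewrite le_max lexx.
have ndf : {homo f : s t / s <= t}.
  move=> s t st; rewrite lerN2; apply: dec => //.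
    by rewrite ge_max T_max le_max st orbT.
  by move=> q /andP[sq _]; apply: above; exact: le_trans sq.
have ubf : has_ubound (range f).
  by exists (- v) => _ [t _ <-]; rewrite lerN2 ltW // above.
exists (- sup (range f)).
have cvf := nondecreasing_cvgr ndf ubf.
apply: (cvg_trans _ (cvgN cvf)); apply: near_eq_cvg.
near=> t; rewrite /f /= opprK max_r //; near: t; exact: nbhs_pinfty_ge.
Unshelve. all: by end_near. Qed.

Lemma cvg_linear_growth_le0 (R : realType) (u : R -> R) (l k T : R) :
  u t @[t --> +oo] --> l ->
  (forall t, T <= t -> k * (t - T) <= u t - u T) -> k <= 0.
Proof.
move=> ul grow; rewrite leNgt; apply/negP => k0.
have [M [_ uM]] : \forall t \near +oo_R, u t < l + 1.
  by apply: (cvgr_lt l) => //; rewrite ltrDl.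
pose t := `|M| + 1 + `|T| + `|(l + 1 - u T) / k|.
have Mt : M < t.
  rewrite /t; have := ler_norm M; have := normr_ge0 T.
  by have := normr_ge0 ((l + 1 - u T) / k); lra.
have Tt : T + (l + 1 - u T) / k <= t.
  rewrite /t; have := ler_norm T; have := ler_norm ((l + 1 - u T) / k).
  by have := normr_ge0 M; lra.
have T't : T <= t.
  rewrite /t; have := ler_norm T; have := normr_ge0 ((l + 1 - u T) / k).
  by have := normr_ge0 M; lra.
have := uM t Mt; have := grow t T't.
by move: Tt; rewrite -lerBrDl ler_pdivrMr // mulrC; lra.
Qed.

(* Above the limit c of w the function u can only decrease, below it can only
   increase; so either u tends to c, or it stays on one side of c, where it is
   monotone and bounded. *)
Lemma follower_cvg (R : realType) (h u w : R -> R) (c : R) :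
  (forall s t : R, 0 <= s -> s <= t -> scalar_abs_continuous s t u) ->
  (forall y s t : R, 0 <= s -> s <= t -> (forall q, s <= q <= t -> y < w q - u q) ->
    h y * (t - s) <= u t - u s) ->
  (forall y s t : R, 0 <= s -> s <= t -> (forall q, s <= q <= t -> w q - u q < y) ->
    u t - u s <= h y * (t - s)) ->
  h 0 = 0 -> w t @[t --> +oo] --> c ->
  exists2 l : R, u t @[t --> +oo] --> l &
    (forall y, y < c - l -> h y <= 0) /\ (forall y, c - l < y -> 0 <= h y).
Proof.
move=> acu lo up h0 wc.
have eventually (P : R -> Prop) : (\forall t \near +oo_R, P t) ->
    exists2 T : R, 0 <= T & forall t, T <= t -> P t.
  move=> [M [_ MP]]; exists (Num.max 0 (M + 1)); first by rewrite le_max lexx.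
  by move=> t; rewrite ge_max => /andP[_ Mt]; apply: MP; lra.
have [l ul] : exists l : R, u t @[t --> +oo] --> l.
  (* Without convergence, only the other alternative of the barrier lemma remains, at every level
     above [c] and, for [- u], below [c]. This squeezes [u] to [c], a contradiction. *)
  apply: contrapT => nul.
  have above v : c < v -> \forall t \near +oo_R, u t <= v.
    move=> cv; have [T T0 wT] := eventually _ (cvgr_lt _ wc _ cv).
    have [||//|//] := @upper_barrier_cvg _ u v T.
      by move=> s t Ts; apply: acu; exact: le_trans Ts.
    (* Eventually [w < v], so [w - u < 0] wherever [u > v]; then [up] at level 0, with [h 0 = 0],
       forbids an increase. *)
    move=> s t Ts st uv; rewrite -subr_le0 -(mul0r (t - s)) -h0.
    apply: up => //; first exact: le_trans Ts.
    move=> q /andP[sq qt]; have := wT q (le_trans Ts sq).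
    by have := uv q; rewrite sq qt => /(_ isT); lra.
  have below v : v < c -> \forall t \near +oo_R, v <= u t.
    move=> cv; have [T T0 wT] := eventually _ (cvgr_gt _ wc _ cv).
    have [|||] := @upper_barrier_cvg _ (fun t => - u t) (- v) T.
    - move=> s t Ts st; apply: scalar_abs_continuousN.
      by apply: acu => //; exact: le_trans Ts.
    - move=> s t Ts st uv; rewrite lerN2 -subr_ge0 -(mul0r (t - s)) -h0.
      apply: lo => //; first exact: le_trans Ts.
      move=> q /andP[sq qt]; have := wT q (le_trans Ts sq).
      by have := uv q; rewrite sq qt => /(_ isT); lra.
    - move=> [l /cvgN ul]; case: nul; exists (- l).
      by apply: cvg_trans ul; apply: near_eq_cvg; near=> t; rewrite opprK.
    - by apply: filterS => t; rewrite lerN2.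
  apply: nul; exists c; apply/cvgrPdist_le => e e0.
  near=> t; apply/ler_normlP; split.
    rewrite opprB lerBlDl; near: t; apply: above; lra.
  rewrite lerBlDr -lerBlDl; near: t; apply: below; lra.
have wul : (w t - u t) @[t --> +oo] --> c - l by exact: cvgB.
exists l => //; split => y ycl.
  (* Eventually [w - u > y], so [u] grows at rate at least [h y]; as [u] converges, this rate cannot
     be positive. *)
  have [T T0 wT] := eventually _ (cvgr_gt _ wul _ ycl).
  apply: (cvg_linear_growth_le0 (T := T) ul) => t Tt.
  by apply: lo => // q /andP[Tq _]; exact: wT.
have [T T0 wT] := eventually _ (cvgr_lt _ wul _ ycl).
rewrite -oppr_le0; apply: (cvg_linear_growth_le0 (T := T) (cvgN ul)) => t Tt.
rewrite mulNr /= -opprD lerN2; apply: up => // q /andP[Tq _]; exact: wT.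
Unshelve. all: by end_near. Qed.

Lemma abs_continuous_slope_le (R : realType) (f : R -> R) (a b k : R) :
  a <= b -> scalar_abs_continuous a b f ->
  {ae (@lebesgue_measure R),
    forall t, a <= t <= b -> derivable f t 1 /\ 'D_1 f t <= k} ->
  f b - f a <= k * (b - a).
Proof.
move=> ab acf aef.
have := @abs_continuous_slope_ge _ (fun t => - f t) a b (- k) ab
  (scalar_abs_continuousN acf).
rewrite mulNr -opprD lerN2; apply; apply: negligibleS aef => t /= nH H.
apply: nH => /H[df kf]; split; first exact: derivableN.
by rewrite [leRHS]deriveN // lerN2.
Qed.

(** * Coordinates, null sets and the Filippov map *)

Lemma coord_le_euclid_norm (R : realType) (p : nat) (x : 'cV[R]_p) (i : 'I_p) :
  `|x i 0| <= euclid_norm x.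
Proof.
rewrite -sqrtr_sqr ler_wsqrtr // (bigD1 i) //= lerDl.
by apply: sumr_ge0 => j _; exact: sqr_ge0.
Qed.

Lemma abs_continuous_coord (R : realType) (p : nat) (a b : R)
    (x : R -> 'cV[R]_p) (i : 'I_p) :
  abs_continuous a b x -> scalar_abs_continuous a b (fun t => x t i 0).
Proof.
move=> acx e e0; have [d d0 H] := acx e e0; exists d => // N s t h tI ltd.
apply: le_lt_trans (H N s t h tI ltd); apply: ler_sum => k _.
by have := coord_le_euclid_norm (x (t k) - x (s k)) i; rewrite !mxE.
Qed.

(** One-point boxes have volume 0 only in positive dimension, whence [p.+1]: in dimension 0 the
    empty product is 1. *)
Lemma lebesgue_outer0 (R : realType) (p : nat) :
  lebesgue_outer (set0 : set 'cV[R]_p.+1) = 0%E.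
Proof.
apply/eqP; rewrite eq_le; apply/andP; split.
  apply: ereal_inf_lbound; exists (fun=> (0, 0)); first by split.
  by apply: eseries0 => k _ _; rewrite /box_volume big_ord_recl !mxE subrr mul0r.
apply: le_ereal_inf_tmp => _ [c [clh _] <-]; apply: nneseries_ge0 => k _ _.
by rewrite lee_fin; apply: prodr_ge0 => i _; rewrite subr_ge0.
Qed.

(** The vectors whose [i]-th coordinate lies in [A] form a closed convex set, which therefore
    contains the hull taken with radius [r] and the null set [set0]. *)
Lemma filippov_coord (R : realType) (p : nat) (X : 'cV[R]_p.+1 -> 'cV[R]_p.+1)
    (x v : 'cV[R]_p.+1) (i : 'I_p.+1) (A : set R) (r : R) :
  filippov X x v -> closed A -> is_interval A -> 0 < r ->
  (forall y, euclid_norm (y - x) < r -> A (X y i 0)) -> A (v i 0).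
Proof.
move=> Fv cA iA r0 XA.
pose C : set 'cV[R]_p.+1 := [set v | A (v i 0)].
apply: (Fv r r0 set0 (lebesgue_outer0 R p) C); split.
- apply: (@preimage_closed _ _ (fun v : 'cV[R]_p.+1 => v i 0)) cA => y _.
  exact: coord_continuous.
- move=> y z l; rewrite !inE /C /= => Ay Az.
  rewrite !mxE; set yi := y i 0 in Ay *; set zi := z i 0 in Az *.
  have l0 : 0 <= l%:num by [].
  have l1 : l%:num <= 1 by [].
  rewrite /onem; set c := l%:num in l0 l1 *.
  have [yz|zy] := leP yi zi.
    by apply: (iA yi zi) => //; apply/andP; split; nra.
  by apply: (iA zi yi) => //; apply/andP; split; nra.
- by move=> _ [y [yx _] <-]; exact: XA.
Qed.

(** Boxes covering a whole interval have total length at least [b - a], by sigma-subadditivity of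
    Lebesgue measure on the line. *)
Lemma null_set_avoids_interval (R : realType) (S : set 'cV[R]_1) (a b : R) :
  lebesgue_outer S = 0%E -> a < b -> exists2 y, a < y < b & ~ S y%:M.
Proof.
move=> S0 ab; apply: contrapT => hS.
have {}hS y : a < y < b -> S y%:M.
  by move=> yab; apply: contrapT => Sy; apply: hS; exists y.
suff : ((b - a)%:E <= lebesgue_outer S)%E by rewrite S0 lee_fin leNgt subr_gt0 ab.
apply: le_ereal_inf_tmp => _ [c [clh Sc] <-].
have -> : (b - a)%:E = lebesgue_measure `]a, b[%classic.
  by rewrite lebesgue_measure_itv /= lte_fin ab.
have -> : (\sum_(0 <= k <oo) (box_volume (c k).1 (c k).2)%:E)%E =
  (\sum_(0 <= k <oo)
    lebesgue_measure `[((c k).1 0 0)%R, ((c k).2 0 0)%R]%classic)%E.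
  apply: eq_eseriesr => k _; rewrite lebesgue_measure_itv /= lte_fin.
  rewrite /box_volume big_ord1; have := clh k 0.
  by rewrite le_eqVlt => /orP[/eqP ->|->]; rewrite ?ltxx ?subrr.
apply: measure_sigma_subadditive => //.
move=> y /=; rewrite in_itv /= => /hS /Sc[k _ /(_ 0)]; rewrite mxE mulr1n => yk.
by exists k => //=; rewrite in_itv.
Qed.

(** Whatever null set is removed, points remain on both sides of [z] within distance [d], and 0 lies
    between the values of [g] there. *)
Lemma filippov1_contains0 (R : realType) (g : R -> R) (z : R) :
  (forall y, y < z -> g y <= 0) -> (forall y, z < y -> 0 <= g y) ->
  filippov1 g z 0.
Proof.
move=> gl gr d /= d0 S /= S0 C [_ cC XC].
have mem y : `|y - z| < d -> ~ S y%:M -> C (g y)%:M.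
  move=> yd Sy; apply: XC; exists y%:M; last by rewrite mxE mulr1n.
  split => //; rewrite /euclid_ball /= /euclid_norm big_ord1 !mxE !mulr1n.
  by rewrite sqrtr_sqr.
have [y1 /andP[zy1 y1z] Sy1] :=
  null_set_avoids_interval S0 (ltac:(lra) : z - d < z).
have [y2 /andP[zy2 y2z] Sy2] :=
  null_set_avoids_interval S0 (ltac:(lra) : z < z + d).
have C1 : C (g y1)%:M by apply: mem => //; apply/ltr_normlP; split; lra.
have C2 : C (g y2)%:M by apply: mem => //; apply/ltr_normlP; split; lra.
have g1 := gl _ y1z; have g2 := gr _ zy2.
have [g20|g2n0] := eqVneq (g y2) 0; first by rewrite -g20.
have g2p : 0 < g y2 by rewrite lt_neqAle eq_sym g2n0.
(* This is the weight [l] on [g y1] solving [l * g y1 + (1 - l) * g y2 = 0]; the denominator is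
   positive since [g y2 > 0 >= g y1]. *)
have l0 : 0 <= g y2 / (g y2 - g y1) by apply: divr_ge0; lra.
have l1 : g y2 / (g y2 - g y1) <= 1 by rewrite ler_pdivrMr; lra.
have := cC (g y1)%:M (g y2)%:M (Itv01 l0 l1); rewrite !inE => /(_ C1 C2).
suff -> : conv (Itv01 l0 l1) ((g y1)%:M : convex_lmodType 'cV[R]_1) (g y2)%:M
  = (0 : R)%:M by [].
apply/matrixP => i j; rewrite !ord1 !mxE /= !mulr1n /onem.
by field; apply/eqP; lra.
Qed.

Lemma euclid_norm_le_sum (R : realType) (p : nat) (x : 'cV[R]_p) :
  euclid_norm x <= \sum_(i < p) `|x i 0|.
Proof.
have s0 : 0 <= \sum_(i < p) `|x i 0| by apply: sumr_ge0.
rewrite -(ger0_norm s0) -sqrtr_sqr ler_wsqrtr // expr2 mulr_sumr.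
apply: ler_sum => i _; rewrite -real_normK ?num_real // expr2 ler_wpM2r //.
by rewrite (bigD1 i) //= lerDl sumr_ge0.
Qed.

(** * Edge differences in a spanning tree *)

(** Self-loops are excluded because their incidence column holds a single 1 and no -1. *)
Lemma edge_diffE (R : realType) (n m : nat) (G : wdigraph R n m) (i : 'I_m)
    (x : 'cV[R]_n) :
  src G i != tgt G i -> edge_diff G i x = x (src G i) 0 - x (tgt G i) 0.
Proof.
move=> neq; rewrite /edge_diff !mxE (bigD1 (src G i)) //= !mxE eqxx mul1r.
congr (_ + _); rewrite (bigD1 (tgt G i)) 1?eq_sym //= !mxE (negPf neq) eqxx.
rewrite mulN1r big1 ?addr0 // => j /andP[js jt].
by rewrite !mxE eq_sym (negPf js) eq_sym (negPf jt) mul0r.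
Qed.

Lemma edge_diff_near (R : realType) (n m : nat) (G : wdigraph R n m) (i : 'I_m)
    (x y : 'cV[R]_n) (r : R) :
  src G i != tgt G i -> euclid_norm (y - x) < r / 2 ->
  `|edge_diff G i y - edge_diff G i x| < r.
Proof.
move=> neq yx; rewrite !edge_diffE //.
have := coord_le_euclid_norm (y - x) (src G i).
have := coord_le_euclid_norm (y - x) (tgt G i).
rewrite !mxE => ht hs.
have -> : y (src G i) 0 - y (tgt G i) 0 - (x (src G i) 0 - x (tgt G i) 0) =
  (y (src G i) 0 - x (src G i) 0) - (y (tgt G i) 0 - x (tgt G i) 0) by ring.
by apply: (le_lt_trans (ler_normB _ _)); lra.
Qed.

Lemma spanning_tree_edge_neq (R : realType) (n m : nat) (G : wdigraph R n m)
    (r : 'I_n) (i : 'I_m) :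
  directed_spanning_tree G r -> src G i != tgt G i.
Proof.
move=> [uniq_in root_in reach]; apply/negP => /eqP loop.
(* a self-loop would be the only edge into its node, which is then unreachable *)
suff /(_ r (root_in i)) avoid v :
    tgt G i != v -> forall q, path (edge_rel G) v q -> tgt G i != last v q.
  have /connectP[q pq lq] := reach (tgt G i).
  by have := avoid q pq; rewrite -lq eqxx.
move=> iv q; elim: q v iv => //= w q IH v iv /andP[/existsP[k /andP[/eqP sk]]].
move=> /eqP tk; apply: IH; apply/eqP => iw.
(* The only edge into the target of [i] is [i] itself, a loop, so the path was already at that node
   one step earlier. *)
have [k' [_ uk']] := uniq_in w (ltac:(by rewrite -iw; exact: root_in)).
have ki : k = i by rewrite -(uk' k tk) (uk' i iw).
by move: iv; rewrite -sk ki loop eqxx.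
Qed.

(** * Solutions along the edges of the tree *)

Section tree_solution.
Context {R : realType} {m : nat} (G : wdigraph R m.+1 m).
Hypothesis htree : directed_spanning_tree G ord0.
Hypothesis hlabel : forall i : 'I_m, tgt G i = lift ord0 i.
Hypothesis hweight : forall i : 'I_m, 0 < weight G i.
Context (g : R -> R).
Hypothesis hmono : {homo g : y z / y <= z}.
Hypothesis hg0 : g 0 = 0.
Context (x : R -> 'cV[R]_m.+1).
Hypothesis hx : filippov_solution (tree_field G g) x.

Let acx (j : 'I_m.+1) (s t : R) : 0 <= s -> s <= t ->
  scalar_abs_continuous s t (fun t => x t j 0).
Proof. by move=> s0 st; apply: abs_continuous_coord; exact: hx.1. Qed.

(** Turns bounds on the field near the trajectory into bounds on almost every velocity. The interval
    [A] is a half-line along an edge and [[set 0]] at the root. *)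
Lemma filippov_solution_coord (j : 'I_m.+1) (s t : R) (A : set R) :
  0 <= s -> closed A -> is_interval A ->
  (forall q, s <= q <= t -> exists2 r, 0 < r & forall y,
     euclid_norm (y - x q) < r -> A (tree_field G g y j 0)) ->
  {ae (@lebesgue_measure R), forall q, s <= q <= t ->
     derivable (fun q => x q j 0) q 1 /\ A ('D_1 (fun q => x q j 0) q)}.
Proof.
move=> s0 cA iA loc; apply: negligibleS hx.2 => q /= nH H; apply: nH => /andP[sq qt].
have [dx Fx] := H (le_trans s0 sq).
split; first by have /derivable_mxP := dx; exact.
have [r r0 rA] := loc q (ltac:(by rewrite sq)).
by have := filippov_coord Fx cA iA r0 rA; rewrite derive_mx // mxE.
Qed.

Lemma tree_field_edge (i : 'I_m) (y : 'cV[R]_m.+1) :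
  tree_field G g y (tgt G i) 0 = weight G i * g (edge_diff G i y).
Proof. by rewrite hlabel mxE liftK. Qed.

(** The strict inequality persists on a ball around each point of the trajectory, where monotonicity
    of [g] bounds the field without any continuity. *)
Lemma edge_growth_ge (i : 'I_m) (y s t : R) : 0 <= s -> s <= t ->
  (forall q, s <= q <= t -> y < x q (src G i) 0 - x q (tgt G i) 0) ->
  weight G i * g y * (t - s) <= x t (tgt G i) 0 - x s (tgt G i) 0.
Proof.
move=> s0 st lt_y; have neq := spanning_tree_edge_neq i htree.
apply: (@abs_continuous_slope_ge _ (fun t => x t (tgt G i) 0)) => //.
  exact: acx.
apply: (@filippov_solution_coord _ s t [set v | weight G i * g y <= v]) => //.
- by move=> a b /= ya yb z /andP[az _]; exact: le_trans az.
- move=> q /lt_y; rewrite -edge_diffE // => yq.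
  (* Half the gap, since both end coordinates of the edge may move by the radius. *)
  exists ((edge_diff G i (x q) - y) / 2) => [|z zq /=].
    by rewrite divr_gt0 // subr_gt0.
  rewrite tree_field_edge ler_wpM2l ?(ltW (hweight i)) //; apply: hmono.
  by have /ltr_normlP[] := edge_diff_near neq zq; lra.
Qed.

Lemma edge_growth_le (i : 'I_m) (y s t : R) : 0 <= s -> s <= t ->
  (forall q, s <= q <= t -> x q (src G i) 0 - x q (tgt G i) 0 < y) ->
  x t (tgt G i) 0 - x s (tgt G i) 0 <= weight G i * g y * (t - s).
Proof.
move=> s0 st lt_y; have neq := spanning_tree_edge_neq i htree.
apply: (@abs_continuous_slope_le _ (fun t => x t (tgt G i) 0)) => //.
  exact: acx.
apply: (@filippov_solution_coord _ s t [set v | v <= weight G i * g y]) => //.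
- by move=> a b /= ya yb z /andP[_ zb]; exact: le_trans yb.
- move=> q /lt_y; rewrite -edge_diffE // => yq.
  exists ((y - edge_diff G i (x q)) / 2) => [|z zq /=].
    by rewrite divr_gt0 // subr_gt0.
  rewrite tree_field_edge ler_wpM2l ?(ltW (hweight i)) //; apply: hmono.
  by have /ltr_normlP[] := edge_diff_near neq zq; lra.
Qed.

Lemma root_constant (t : R) : 0 <= t -> x t ord0 0 = x 0 ord0 0.
Proof.
move=> t0.
have ae0 : {ae (@lebesgue_measure R), forall q, 0 <= q <= t ->
    derivable (fun q => x q ord0 0) q 1 /\ 'D_1 (fun q => x q ord0 0) q = 0}.
  apply: (@filippov_solution_coord _ 0 t [set 0]) => //.
  - move=> a b /= -> -> z /andP[z0 z0']; apply/eqP.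
    by rewrite eq_le z0 z0'.
  - by move=> q _; exists 1 => // y _ /=; rewrite mxE unlift_none.
have := @abs_continuous_slope_le _ (fun q => x q ord0 0) 0 t 0 t0.
have := @abs_continuous_slope_ge _ (fun q => x q ord0 0) 0 t 0 t0.
rewrite mul0r subr_ge0 subr_le0 => ge0 le0; apply/eqP; rewrite eq_le.
apply/andP; split; [apply: le0|apply: ge0]; try exact: acx.
  by apply: negligibleS ae0 => q /= nH H; apply: nH => /H[? ->].
by apply: negligibleS ae0 => q /= nH H; apply: nH => /H[? ->].
Qed.

Lemma edge_cvg (i : 'I_m) (c : R) : x t (src G i) 0 @[t --> +oo] --> c ->
  exists2 l : R, x t (tgt G i) 0 @[t --> +oo] --> l &
    (forall y, y < c - l -> g y <= 0) /\ (forall y, c - l < y -> 0 <= g y).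
Proof.
move=> srcc.
have [|y s t|y s t||l tgtl [gl gr]] := @follower_cvg _ (fun y => weight G i * g y)
  (fun t => x t (tgt G i) 0) (fun t => x t (src G i) 0) c _ _ _ _ srcc.
- by move=> s t; exact: acx.
- exact: edge_growth_ge.
- exact: edge_growth_le.
- by rewrite hg0 mulr0.
exists l => //; split => y h.
  by have := gl y h; rewrite pmulr_rle0.
by have := gr y h; rewrite pmulr_rge0.
Qed.

Lemma node_cvg (v : 'I_m.+1) : exists c : R, x t v 0 @[t --> +oo] --> c.
Proof.
have [_ _ /(_ v)/connectP[q pq ->]] := htree.
have : exists c : R, x t ord0 0 @[t --> +oo] --> c.
  exists (x 0 ord0 0); apply: cvg_near_cst.
  by exists 0; split => // t /ltW /root_constant ->.
(* The starting node is generalised, so that the induction carries the limit forward along the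
   path. *)
elim: q (ord0 : 'I_m.+1) pq => //= w q IH u /andP[/existsP[k]].
move=> /andP[/eqP <- /eqP <-] pq [c /edge_cvg[l cl _]].
by apply: IH pq _; exists l.
Qed.

Lemma filippov_solution_cvg_H3 :
  exists2 c, H3 G g c & forall j, x t j 0 @[t --> +oo] --> (c j 0 : R).
Proof.
pose c : 'cV[R]_m.+1 := \col_j sval (cid (node_cvg j)).
have xc j : x t j 0 @[t --> +oo] --> (c j 0 : R).
  by rewrite mxE; exact: svalP (cid (node_cvg j)).
(* The choice [alpha = 0] is admissible at 0 because [g] is monotone with [g 0 = 0]. *)
exists c => //; exists 0.
  by apply: filippov1_contains0 => y /ltW /hmono; rewrite hg0.
move=> i; exists 0; last by rewrite mulr0.
have [l tl [gl gr]] := edge_cvg (xc (src G i)).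
(* [edge_cvg] produces its own limit at the target; uniqueness of limits identifies it with the
   chosen coordinate of [c]. *)
have El : c (tgt G i) 0 = l := cvg_unique (@Rhausdorff R) (xc (tgt G i)) tl.
rewrite edge_diffE ?El; last exact: spanning_tree_edge_neq htree.
exact: filippov1_contains0.
Qed.

End tree_solution.

(** * From coordinatewise limits to the distance *)

Theorem mainTheorem5 (R : realType) (m : nat) (hm : (0 < m)%N)
  (G : wdigraph R m.+1 m)
  (htree : directed_spanning_tree G ord0)
  (hlabel : forall i : 'I_m, tgt G i = lift ord0 i)
  (hweight : forall i : 'I_m, 0 < weight G i)
  (g : R -> R)
  (hmono : {homo g : y z / y <= z})
  (hlim : `|g y| @[y --> +oo] --> +oo)
  (hg0 : g 0 = 0)
  (x : R -> 'cV[R]_m.+1)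
  (hx : filippov_solution (tree_field G g) x) :
  euclid_dist (x t) (H3 G g) @[t --> +oo] --> 0%E.
Proof.
have [c Hc xc] := filippov_solution_cvg_H3 htree hlabel hweight hmono hg0 hx.
(* As [c] lies in [H3 G g], the distance is at most the norm of [x t - c], hence at most the sum of
   the coordinate errors. *)
apply: (@squeeze_cvge _ _ _ _ (cst 0%E) _
    (fun t => (\sum_j `|x t j 0 - c j 0|)%:E)).
- near=> t; apply/andP; split.
    apply: le_ereal_inf_tmp => _ [y _ <-].
    by rewrite lee_fin; exact: sqrtr_ge0.
  apply: (@le_trans _ _ (euclid_norm (x t - c))%:E).
    by apply: ereal_inf_lbound; exists c.
  rewrite lee_fin (le_trans (euclid_norm_le_sum _)) //.
  by apply: ler_sum => j _; rewrite !mxE.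
- exact: cvg_cst.
- apply: cvg_EFin; first by near=> t.
  (* Writing 0 as a sum of [|c j 0 - c j 0|] lets the limit be taken term by term. *)
  rewrite [X in _ --> X](_ : _ = \sum_(j < m.+1) `|c j 0 - c j 0|); last first.
    by rewrite big1 // => j _; rewrite subrr normr0.
  apply: cvg_big; first exact: add_continuous.
  move=> j _; apply: cvg_norm; apply: cvgB; first exact: xc.
  exact: cvg_cst.
Unshelve. all: by end_near. Qed.
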